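(* Let $\mathsf{M}$ be a theory with provability predicate $\Box$ as described in the context, and let $Y^J(k)$, $Y^G(k)$, $Y^H(k)$ be formulas of the language of $\mathsf{M}$ with the single free variable $k$ such that \begin{align*} \mathsf{M}&\vdash Y^J(k) \leftrightarrow (\forall x > k)\,[\Box(\ulcorner \neg Y^J(\dot{x})\urcorner)],\\ \mathsf{M}&\vdash Y^G(k) \leftrightarrow (\forall x > k)\,[\neg\Box(\ulcorner Y^G(\dot{x})\urcorner)],\\ \mathsf{M}&\vdash Y^H(k) \leftrightarrow (\forall x > k)\,[\Box(\ulcorner Y^H(\dot{x})\urcorner)]. \end{align*} Then: (1) For every natural number $k$: (a) if $\mathsf{M}$ is $1$-consistent, then $\mathsf{M}\nvdash Y^J(\bar{k})$; (b) if $\mathsf{M}$ is consistent, then $\mathsf{M}\nvdash \neg Y^J(\bar{k})$. (2) For every natural number $k$: (a) if $\mathsf{M}$ is consistent, then $\mathsf{M}\nvdash Y^G(\bar{k})$; (b) if $\mathsf{M}$ is $1$-consistent, then $\mathsf{M}\nvdash \neg Y^G(\bar{k})$. (3) $\mathsf{M}\vdash Y^H(k)$, with $k$ a free variable.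
   Context: $\mathsf{M}$ is a recursively enumerable first-order theory (classical logic) of reasonable power in the language of arithmetic, for instance Peano arithmetic $\mathsf{PA}$; ''reasonable power'' may be read as: $\mathsf{M}$ extends elementary arithmetic $I\Delta_0+\mathrm{exp}$. Notation. $\bar{k}$ is the numeral of the natural number $k$. $\ulcorner\phi\urcorner$ is the numeral of the Gödel number of $\phi$. With $x$ a variable, $\ulcorner\phi(\dot{x})\urcorner$ denotes the ($\mathsf{M}$-definable) function of $x$ whose value at $n$ is the Gödel number of the sentence $\phi(\bar{n})$ (similarly for several variables), so that $x$ is free in $\Box(\ulcorner\phi(\dot{x})\urcorner)$. $x\,\underline{\rightarrow}\,y$ denotes the arithmetized function taking Gödel numbers of two formulas to the Gödel number of the implication between them. $\Box$ is a standard provability predicate for $\mathsf{M}$: a $\Sigma_1$ formula with one free variable, true in the standard model of exactly the Gödel numbers of theorems of $\mathsf{M}$, and satisfying the generalized derivability conditions: (GD1) if $\mathsf{M}\vdash\phi(x)$ then $\mathsf{M}\vdash\Box(\ulcorner\phi(\dot{x})\urcorner)$; (GD2) $\mathsf{M}\vdash\Box(x\,\underline{\rightarrow}\,y)\rightarrow(\Box(x)\rightarrow\Box(y))$; (GD3) for every $\Sigma_1$ formula $\psi(y_1,\ldots,y_n)$, $\mathsf{M}\vdash\psi(y_1,\ldots,y_n)\rightarrow\Box(\ulcorner\psi(\dot{y}_1,\ldots,\dot{y}_n)\urcorner)$. Formulas $Y^J,Y^G,Y^H$ as in the claim exist by the diagonal lemma with free variables. $\mathsf{M}$ is $1$-consistent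 if every $\Sigma_1$ sentence provable in $\mathsf{M}$ is true in the standard model. *)

(* Defs.v *)
From Stdlib Require Import Arith List Lia Psatz.
Import ListNotations.

(** The language is {0, S, +, *, =, <}, with de Bruijn indices: in [All f] the
    index 0 of [f] is the bound variable. *)

Inductive term : Type :=
| Var (i : nat)
| Zero
| Succ (t : term)
| Plus (t u : term)
| Mult (t u : term).

Inductive form : Type :=
| Bot
| Eq (t u : term)
| Lt (t u : term)
| Imp (f g : form)
| All (f : form).

Definition Neg (f : form) : form := Imp f Bot.
Definition Ex (f : form) : form := Neg (All (Neg f)).
Definition And (f g : form) : form := Neg (Imp f (Neg g)).
Definition Iff (f g : form) : form := And (Imp f g) (Imp g f).

Definition scons {A : Type} (a : A) (s : nat -> A) (i : nat) : A :=
  match i with 0 => a | S j => s j end.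

Fixpoint subst_term (s : nat -> term) (t : term) : term :=
  match t with
  | Var i => s i
  | Zero => Zero
  | Succ t => Succ (subst_term s t)
  | Plus t u => Plus (subst_term s t) (subst_term s u)
  | Mult t u => Mult (subst_term s t) (subst_term s u)
  end.

Definition shift_term : term -> term := subst_term (fun i => Var (S i)).

Definition up (s : nat -> term) : nat -> term :=
  scons (Var 0) (fun i => shift_term (s i)).

Fixpoint subst (s : nat -> term) (f : form) : form :=
  match f with
  | Bot => Bot
  | Eq t u => Eq (subst_term s t) (subst_term s u)
  | Lt t u => Lt (subst_term s t) (subst_term s u)
  | Imp f g => Imp (subst s f) (subst s g)
  | All f => All (subst (up s) f)
  end.

Definition shift : form -> form := subst (fun i => Var (S i)).

(** [inst f t] is [f] with [t] for the variable 0; the other variables move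
    down by one. *)
Definition inst (f : form) (t : term) : form := subst (scons t Var) f.

Fixpoint term_bounded (n : nat) (t : term) : Prop :=
  match t with
  | Var i => i < n
  | Zero => True
  | Succ t => term_bounded n t
  | Plus t u | Mult t u => term_bounded n t /\ term_bounded n u
  end.

(** All free variables of [f] are among 0, ..., n-1. *)
Fixpoint bounded (n : nat) (f : form) : Prop :=
  match f with
  | Bot => True
  | Eq t u | Lt t u => term_bounded n t /\ term_bounded n u
  | Imp f g => bounded n f /\ bounded n g
  | All f => bounded (S n) f
  end.

Definition sentence : form -> Prop := bounded 0.

Fixpoint num (n : nat) : term :=
  match n with 0 => Zero | S n => Succ (num n) end.

(** In [AllI] the axioms are not shifted, so [T] should consist of sentences. *)
Inductive derives (T : form -> Prop) : list form -> form -> Prop :=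
| Ax G f : T f -> derives T G f
| Hyp G f : In f G -> derives T G f
| ImpI G f g : derives T (f :: G) g -> derives T G (Imp f g)
| ImpE G f g : derives T G (Imp f g) -> derives T G f -> derives T G g
| RAA G f : derives T (Neg f :: G) Bot -> derives T G f
| AllI G f : derives T (map shift G) f -> derives T G (All f)
| AllE G f t : derives T G (All f) -> derives T G (inst f t)
| EqI G t : derives T G (Eq t t)
| EqE G f t u :
    derives T G (Eq t u) -> derives T G (inst f t) -> derives T G (inst f u).

Definition proves (T : form -> Prop) (f : form) : Prop := derives T [] f.

Notation "T |-- f" := (proves T f) (at level 70, no associativity).

Definition consistent (T : form -> Prop) : Prop := ~ (T |-- Bot).

Fixpoint eval (e : nat -> nat) (t : term) : nat :=
  match t with
  | Var i => e i
  | Zero => 0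
  | Succ t => S (eval e t)
  | Plus t u => eval e t + eval e u
  | Mult t u => eval e t * eval e u
  end.

Fixpoint sat (e : nat -> nat) (f : form) : Prop :=
  match f with
  | Bot => False
  | Eq t u => eval e t = eval e u
  | Lt t u => eval e t < eval e u
  | Imp f g => sat e f -> sat e g
  | All f => forall n, sat (scons n e) f
  end.

Definition true_in_N (f : form) : Prop := forall e, sat e f.

Inductive Delta0 : form -> Prop :=
| D0_Bot : Delta0 Bot
| D0_Eq t u : Delta0 (Eq t u)
| D0_Lt t u : Delta0 (Lt t u)
| D0_Imp f g : Delta0 f -> Delta0 g -> Delta0 (Imp f g)
| D0_BAll t f :
    Delta0 f -> Delta0 (All (Imp (Lt (Var 0) (shift_term t)) f))
| D0_BEx t f :
    Delta0 f -> Delta0 (Ex (And (Lt (Var 0) (shift_term t)) f)).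

Inductive Sigma1 : form -> Prop :=
| S1_Delta0 f : Delta0 f -> Sigma1 f
| S1_Ex f : Sigma1 f -> Sigma1 (Ex f).

Definition one_consistent (T : form -> Prop) : Prop :=
  forall f, Sigma1 f -> sentence f -> T |-- f -> true_in_N f.

(** Goedel's beta function: [r] is the remainder of [a] modulo [1 + (i+1) b]. *)
Definition beta (a b i r : term) : form :=
  let m := Succ (Mult (Succ i) b) in
  And (Lt r m)
      (Ex (Eq (shift_term a)
              (Plus (Mult (Var 0) (shift_term m)) (shift_term r)))).

(** y = 2^x, where y = [Var 0] and x = [Var 1]: some a, b code a sequence that
    starts with 1, doubles at each of the first x steps, and reaches y at x.
    Under the two quantifiers, b, a, y, x are [Var 0], ..., [Var 3]. *)
Definition pow2 : form :=
  Ex (Ex (And (beta (Var 1) (Var 0) Zero (Succ Zero))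
         (And (All (Imp (Lt (Var 0) (Var 4))
                 (Ex (And (beta (Var 3) (Var 2) (Var 1) (Var 0))
                          (beta (Var 3) (Var 2) (Succ (Var 1))
                                (Plus (Var 0) (Var 0)))))))
              (beta (Var 1) (Var 0) (Var 3) (Var 2))))).

(** Axioms are given as open formulas, to be read universally closed.  Over
    the other axioms, [EA_exp] is equivalent to the totality of the usual
    Delta_0 graph of exponentiation: Delta_0 induction along a beta-coded
    sequence of powers of 2 shows that its entries lie on that graph, and
    conversely IDelta_0 + exp proves that the codes exist. *)
Inductive EA : form -> Prop :=
| EA_S_nonzero : EA (Neg (Eq (Succ (Var 0)) Zero))
| EA_S_inj : EA (Imp (Eq (Succ (Var 0)) (Succ (Var 1))) (Eq (Var 0) (Var 1)))
| EA_pred : EA (Imp (Neg (Eq (Var 0) Zero)) (Ex (Eq (Var 1) (Succ (Var 0)))))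
| EA_plus_0 : EA (Eq (Plus (Var 0) Zero) (Var 0))
| EA_plus_S :
    EA (Eq (Plus (Var 0) (Succ (Var 1))) (Succ (Plus (Var 0) (Var 1))))
| EA_mult_0 : EA (Eq (Mult (Var 0) Zero) Zero)
| EA_mult_S :
    EA (Eq (Mult (Var 0) (Succ (Var 1))) (Plus (Mult (Var 0) (Var 1)) (Var 0)))
| EA_lt :
    EA (Iff (Lt (Var 0) (Var 1))
            (Ex (Eq (Plus (Var 1) (Succ (Var 0))) (Var 2))))
| EA_induction f :
    Delta0 f ->
    EA (Imp (inst f Zero)
       (Imp (All (Imp f (subst (scons (Succ (Var 0)) (fun i => Var (S i))) f)))
            (All f)))
| EA_exp : EA (Ex pow2).

(** Programs for the partial recursive functions; [reval p v y] says that [p]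
    halts on the arguments [v] with value [y]. *)
Inductive rfun : Type :=
| RZero
| RSucc
| RProj (i : nat)
| RComp (p : rfun) (qs : list rfun)
| RRec (p q : rfun)
| RMu (p : rfun).

Inductive reval : rfun -> list nat -> nat -> Prop :=
| ev_zero v : reval RZero v 0
| ev_succ x v : reval RSucc (x :: v) (S x)
| ev_proj i v x : nth_error v i = Some x -> reval (RProj i) v x
| ev_comp p qs v ys z :
    Forall2 (fun q y => reval q v y) qs ys ->
    reval p ys z -> reval (RComp p qs) v z
| ev_rec_0 p q v y : reval p v y -> reval (RRec p q) (0 :: v) y
| ev_rec_S p q n v y z :
    reval (RRec p q) (n :: v) y ->
    reval q (n :: y :: v) z -> reval (RRec p q) (S n :: v) z
| ev_mu p v n :
    reval p (n :: v) 0 ->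
    (forall m, m < n -> exists y, reval p (m :: v) (S y)) ->
    reval (RMu p) v n.

Definition recursively_enumerable (A : nat -> Prop) : Prop :=
  exists p, forall n, A n <-> exists y, reval p [n] y.

Definition pair (x y : nat) : nat := (x + y) * (x + y) + x.
Arguments pair : simpl never.

(** A term is coded by the number of its leading successors, paired with a code
    of the rest; [k] counts the successors already removed.  Numerals thus have
    codes polynomial in their value, so that the functions of formal syntax
    needed below are given by terms of the language. *)
Fixpoint gn_term (k : nat) (t : term) : nat :=
  match t with
  | Var i => pair k (pair 0 i)
  | Zero => pair k (pair 1 0)
  | Succ t => gn_term (S k) t
  | Plus t u => pair k (pair 2 (pair (gn_term 0 t) (gn_term 0 u)))
  | Mult t u => pair k (pair 3 (pair (gn_term 0 t) (gn_term 0 u)))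
  end.

Fixpoint gn (f : form) : nat :=
  match f with
  | Bot => pair 0 0
  | Eq t u => pair 1 (pair (gn_term 0 t) (gn_term 0 u))
  | Lt t u => pair 2 (pair (gn_term 0 t) (gn_term 0 u))
  | Imp f g => pair 3 (pair (gn f) (gn g))
  | All f => pair 4 (gn f)
  end.

Lemma pair_inj x y x' y' : pair x y = pair x' y' -> x = x' /\ y = y'.
Proof.
  unfold pair; intros E.
  destruct (Nat.lt_trichotomy (x + y) (x' + y')) as [H|[H|H]]; nia.
Qed.

Lemma gn_term_inj t u j k :
  gn_term j t = gn_term k u -> Nat.iter j Succ t = Nat.iter k Succ u.
Proof.
  revert u j k.
  induction t as [i| |t IH|t1 IH1 t2 IH2|t1 IH1 t2 IH2]; intros u.
  3: { intros j k E; apply (IH u (S j) k) in E; rewrite <- E.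
       now rewrite Nat.iter_succ_r. }
  all: induction u as [i'| |u IHu|u1 _ u2 _|u1 _ u2 _]; intros j k E;
    try (apply (IHu j (S k)) in E; rewrite E; now rewrite Nat.iter_succ_r);
    cbn in E; apply pair_inj in E as [-> E]; apply pair_inj in E as [E0 E];
    try discriminate E0; try (apply pair_inj in E as [E1 E2]).
  - now subst.
  - reflexivity.
  - apply (IH1 u1 0 0) in E1; apply (IH2 u2 0 0) in E2; cbn in *; now subst.
  - apply (IH1 u1 0 0) in E1; apply (IH2 u2 0 0) in E2; cbn in *; now subst.
Qed.

Lemma gn_inj f g : gn f = gn g -> f = g.
Proof.
  revert g.
  induction f as [|t u|t u|f1 IH1 f2 IH2|f IH]; intros [|t' u'|t' u'|g1 g2|g] E;
    cbn in E; apply pair_inj in E as [E0 E]; try discriminate E0.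
  - reflexivity.
  - apply pair_inj in E as [E1 E2].
    apply (gn_term_inj _ _ 0 0) in E1, E2; cbn in *; now subst.
  - apply pair_inj in E as [E1 E2].
    apply (gn_term_inj _ _ 0 0) in E1, E2; cbn in *; now subst.
  - apply pair_inj in E as [E1 E2]; f_equal; auto.
  - f_equal; auto.
Qed.

Definition tpair (x y : term) : term :=
  Plus (Mult (Plus x y) (Plus x y)) x.

(** On Goedel numbers of formulas, this is implication; see [timp_spec]. *)
Definition timp (x y : term) : term := tpair (num 3) (tpair x y).

(** [dot f] is a term with the same free variables as [f].  If these are
    x1, ..., xn, its value at k1, ..., kn is the Goedel number of the sentence
    obtained from [f] by putting the numerals of k1, ..., kn for x1, ..., xn;
    see [dot_spec].  The argument [d] is the number of quantifiers passed: the
    indices below [d] are bound in [f], and coded as variables. *)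
Fixpoint dot_term (d k : nat) (t : term) : term :=
  match t with
  | Var i =>
      if i <? d then tpair (num k) (tpair (num 0) (num i))
      else tpair (Plus (num k) (Var (i - d))) (tpair (num 1) (num 0))
  | Zero => tpair (num k) (tpair (num 1) (num 0))
  | Succ t => dot_term d (S k) t
  | Plus t u =>
      tpair (num k) (tpair (num 2) (tpair (dot_term d 0 t) (dot_term d 0 u)))
  | Mult t u =>
      tpair (num k) (tpair (num 3) (tpair (dot_term d 0 t) (dot_term d 0 u)))
  end.

Fixpoint dot_at (d : nat) (f : form) : term :=
  match f with
  | Bot => tpair (num 0) (num 0)
  | Eq t u => tpair (num 1) (tpair (dot_term d 0 t) (dot_term d 0 u))
  | Lt t u => tpair (num 2) (tpair (dot_term d 0 t) (dot_term d 0 u))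
  | Imp f g => timp (dot_at d f) (dot_at d g)
  | All f => tpair (num 4) (dot_at (S d) f)
  end.

Definition dot (f : form) : term := dot_at 0 f.

Lemma eval_num e n : eval e (num n) = n.
Proof. induction n; cbn; auto. Qed.

Lemma eval_tpair e t u : eval e (tpair t u) = pair (eval e t) (eval e u).
Proof. reflexivity. Qed.

Lemma shift_num n : shift_term (num n) = num n.
Proof. induction n; cbn; [reflexivity | unfold shift_term in *; congruence]. Qed.

Lemma gn_num k n : gn_term k (num n) = pair (k + n) (pair 1 0).
Proof.
  revert k; induction n; intros k; cbn [num gn_term].
  - now rewrite Nat.add_0_r.
  - rewrite IHn; f_equal; lia.
Qed.

Lemma up_iter_num d (e : nat -> nat) i :
  Nat.iter d up (fun j => num (e j)) i =
  if i <? d then Var i else num (e (i - d)).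
Proof.
  revert i; induction d; intros [|i]; cbn [Nat.iter nat_rect up scons];
    try reflexivity.
  unfold up at 1; cbn [scons]; unfold Nat.iter in IHd; rewrite IHd.
  change (S i <? S d) with (i <? d); cbn [Nat.sub].
  destruct (i <? d); [reflexivity | apply shift_num].
Qed.

Lemma dot_term_spec d k e t :
  eval e (dot_term d k t) =
  gn_term k (subst_term (Nat.iter d up (fun i => num (e i))) t).
Proof.
  revert k; induction t; intros k; cbn [dot_term subst_term gn_term];
    rewrite ?eval_tpair, ?eval_num, ?IHt1, ?IHt2, ?IHt; try reflexivity.
  rewrite up_iter_num; destruct (i <? d); cbn [gn_term];
    rewrite ?eval_tpair, ?gn_num; cbn [eval]; now rewrite ?eval_num.
Qed.

Lemma dot_at_spec d e f :
  eval e (dot_at d f) = gn (subst (Nat.iter d up (fun i => num (e i))) f).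
Proof.
  revert d; induction f; intros d; cbn [dot_at subst gn];
    unfold timp;
    rewrite ?eval_tpair, ?eval_num, ?dot_term_spec, ?IHf1, ?IHf2, ?IHf;
    reflexivity.
Qed.

Lemma dot_spec e f : eval e (dot f) = gn (subst (fun i => num (e i)) f).
Proof. exact (dot_at_spec 0 e f). Qed.

Lemma timp_spec e t u f g :
  eval e t = gn f -> eval e u = gn g -> eval e (timp t u) = gn (Imp f g).
Proof.
  intros Ht Hu; unfold timp; rewrite !eval_tpair, eval_num, Ht, Hu; reflexivity.
Qed.

Record arithmetical_theory (M : form -> Prop) : Prop := {
  axioms_closed : forall f, M f -> sentence f;
  axioms_re : recursively_enumerable (fun n => exists f, M f /\ gn f = n);
  extends_EA : forall f, EA f -> M |-- f
}.

Record provability_predicate (M : form -> Prop) (Box : form) : Prop := {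
  box_one_free : bounded 1 Box;
  box_Sigma1 : Sigma1 Box;
  box_true : forall n, sat (fun _ => n) Box <-> exists f, gn f = n /\ M |-- f;
  GD1 : forall f, bounded 1 f -> M |-- f -> M |-- inst Box (dot f);
  GD2 : M |-- Imp (inst Box (timp (Var 0) (Var 1)))
                  (Imp (inst Box (Var 0)) (inst Box (Var 1)));
  GD3 : forall f, Sigma1 f -> M |-- Imp f (inst Box (dot f))
}.

(** For [f] in the variable x = [Var 0]: the formula (forall x > k) f, in the
    variable k = [Var 0]. *)
Definition all_above (f : form) : form := All (Imp (Lt (Var 1) (Var 0)) f).

(* Main.v *)
Require Import Defs.
From Stdlib Require Import Arith List Lia.
Import ListNotations.

(** Write [B f] for [inst Box (dot f)].  Everything rests on Loeb's theorem for
    sentences: if [M] proves [B p -> p], then [M] proves [p].  Its instance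
    [p = Bot] is the second incompleteness theorem, that only an inconsistent
    [M] proves [Neg (B Bot)].

    A theory that declares anything unprovable thereby declares itself
    consistent, because [B Bot] implies every [B f] ([proves_box_mono]).  So
    [M] proves [B Bot -> YJ(k)], and it turns [YG(k)] into [Neg (B Bot)]:
    proving [Neg YJ(k)] or [YG(k)] makes [M] inconsistent by Loeb's theorem.
    The other two unprovability claims reduce to these.  If [M] proves [YJ(k)],
    then it proves the Sigma_1 sentence [B (Neg YJ)] at [k+1]; by 1-consistency
    this is true, so [M] proves [Neg YJ(k+1)].  If [M] proves [Neg YG(k)], then
    it proves that [B YG] holds of something; this is a true Sigma_1 sentence,
    so [M] proves [YG(n)] for some [n].  Finally, for the sentence
    [p = All YH], [B p] implies [B YH] at every number, hence all [YH(k)],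
    which is [p]; so Loeb's theorem proves [p].

    Loeb's theorem needs a fixed point of its own, [L <-> (B L -> p)].  For
    [diagonal], take the formula [g(x) = f(d(x))] with Goedel number [n] and
    let [L] be [forall x, x = n -> g(x)].  This expresses [g(n)] without any
    substitution into [g], so its Goedel number is a polynomial [d] in [n], and
    [d] is a term of the language ([tdiag]).  That [d(n)] is the Goedel number
    of [L] is then an equation between closed terms, which [M] proves by
    computing both sides ([proves_eval]). *)

(** * Substitution *)

Lemma subst_term_ext s s' t :
  (forall i, s i = s' i) -> subst_term s t = subst_term s' t.
Proof. intros E; induction t; cbn; congruence. Qed.

Lemma subst_term_ext_bounded n s s' t :
  term_bounded n t -> (forall i, i < n -> s i = s' i) ->
  subst_term s t = subst_term s' t.
Proof.
  intros Ht E; induction t; cbn in *; try tauto; try auto;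
    f_equal; tauto.
Qed.

Lemma subst_term_id s t : (forall i, s i = Var i) -> subst_term s t = t.
Proof. intros E; induction t; cbn; congruence. Qed.

Lemma subst_term_comp s s' t :
  subst_term s' (subst_term s t) = subst_term (fun i => subst_term s' (s i)) t.
Proof. induction t; cbn; congruence. Qed.

Lemma subst_term_up_shift s t :
  subst_term (up s) (shift_term t) = shift_term (subst_term s t).
Proof. unfold shift_term; now rewrite !subst_term_comp. Qed.

Lemma subst_term_scons_shift u s t :
  subst_term (scons u s) (shift_term t) = subst_term s t.
Proof. unfold shift_term; now rewrite subst_term_comp. Qed.

Lemma inst_shift_term u t : subst_term (scons u Var) (shift_term t) = t.
Proof. rewrite subst_term_scons_shift; now apply subst_term_id. Qed.

Lemma subst_num s n : subst_term s (num n) = num n.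
Proof. induction n; cbn; congruence. Qed.

Lemma up_ext n s s' :
  (forall i, i < n -> s i = s' i) -> forall i, i < S n -> up s i = up s' i.
Proof.
  intros E [|i] Hi; [reflexivity|]; cbn; rewrite E; [reflexivity | lia].
Qed.

Lemma subst_ext s s' f : (forall i, s i = s' i) -> subst s f = subst s' f.
Proof.
  revert s s'; induction f; intros s s' E; cbn; f_equal; auto using subst_term_ext.
  apply IHf; intros [|i]; cbn; congruence.
Qed.

Lemma subst_ext_bounded n s s' f :
  bounded n f -> (forall i, i < n -> s i = s' i) -> subst s f = subst s' f.
Proof.
  revert n s s'; induction f; intros n s s' Hf E; cbn in *;
    try (destruct Hf); f_equal; eauto using subst_term_ext_bounded, up_ext.
Qed.

Lemma subst_id s f : (forall i, s i = Var i) -> subst s f = f.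
Proof.
  revert s; induction f; intros s E; cbn; f_equal; auto using subst_term_id.
  apply IHf; intros [|i]; cbn; rewrite ?E; reflexivity.
Qed.

Lemma subst_bounded_id n s f :
  bounded n f -> (forall i, i < n -> s i = Var i) -> subst s f = f.
Proof.
  intros Hf E; rewrite (subst_ext_bounded n s Var f Hf E); now apply subst_id.
Qed.

Lemma subst_sentence s f : sentence f -> subst s f = f.
Proof. intros Hf; apply (subst_bounded_id 0); [exact Hf | lia]. Qed.

Lemma subst_comp s s' f :
  subst s' (subst s f) = subst (fun i => subst_term s' (s i)) f.
Proof.
  revert s s'; induction f; intros s s'; cbn; f_equal;
    auto using subst_term_comp.
  rewrite IHf; apply subst_ext; intros [|i]; [reflexivity|].
  apply subst_term_up_shift.
Qed.

Lemma subst_inst s f t :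
  subst s (inst f t) = inst (subst (up s) f) (subst_term s t).
Proof.
  unfold inst; rewrite !subst_comp; apply subst_ext; intros [|i]; cbn.
  - reflexivity.
  - now rewrite inst_shift_term.
Qed.

Lemma subst_shift s f : subst (up s) (shift f) = shift (subst s f).
Proof. unfold shift; now rewrite !subst_comp. Qed.

(** As only the variable 0 of [f] is replaced, [s] acts on [t] alone: this moves
    substitutions into the argument of [Box]. *)
Lemma subst_inst_bounded s f t :
  bounded 1 f -> subst s (inst f t) = inst f (subst_term s t).
Proof.
  intros Hf; unfold inst; rewrite subst_comp.
  apply (subst_ext_bounded 1); [exact Hf|]; intros [|i] Hi; [reflexivity | lia].
Qed.

Lemma inst_Var0 f : bounded 1 f -> inst f (Var 0) = f.
Proof.
  intros Hf; apply (subst_bounded_id 1); [exact Hf|].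
  intros [|i] Hi; [reflexivity | lia].
Qed.

Lemma term_bounded_mono n m t : n <= m -> term_bounded n t -> term_bounded m t.
Proof. intros L; induction t; cbn; try tauto; lia. Qed.

Lemma bounded_mono n m f : n <= m -> bounded n f -> bounded m f.
Proof.
  revert n m; induction f; intros n m L; cbn.
  - tauto.
  - intros []; eauto using term_bounded_mono.
  - intros []; eauto using term_bounded_mono.
  - intros []; eauto.
  - apply IHf; lia.
Qed.

Lemma sentence_bounded n f : sentence f -> bounded n f.
Proof. apply bounded_mono; lia. Qed.

Lemma term_bounded_subst n m s t :
  term_bounded n t -> (forall i, i < n -> term_bounded m (s i)) ->
  term_bounded m (subst_term s t).
Proof. intros Ht Hs; induction t; cbn in *; try tauto; auto. Qed.

Lemma bounded_subst n m s f :
  bounded n f -> (forall i, i < n -> term_bounded m (s i)) ->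
  bounded m (subst s f).
Proof.
  revert n m s; induction f; intros n m s Hf Hs; cbn in *;
    try (destruct Hf; split); eauto using term_bounded_subst.
  apply (IHf (S n)); [exact Hf|]; intros [|i] Hi; cbn; [lia|].
  apply (term_bounded_subst m); [apply Hs; lia | intros; cbn; lia].
Qed.

Lemma bounded_inst n f t : bounded 1 f -> term_bounded n t -> bounded n (inst f t).
Proof.
  intros Hf Ht; apply (bounded_subst 1); [exact Hf|].
  intros [|i] Hi; [exact Ht | lia].
Qed.

Lemma term_bounded_num n k : term_bounded n (num k).
Proof. induction k; cbn; auto. Qed.

Lemma term_bounded_tpair n t u :
  term_bounded n t -> term_bounded n u -> term_bounded n (tpair t u).
Proof. cbn; tauto. Qed.

Lemma term_bounded_dot_term n d k t :
  term_bounded (d + n) t -> term_bounded n (dot_term d k t).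
Proof.
  revert k; induction t; intros k Ht; cbn [dot_term term_bounded] in *;
    try (destruct (Nat.ltb_spec i d));
    repeat apply term_bounded_tpair; auto using term_bounded_num;
    try (now apply IHt1); try (now apply IHt2).
  cbn; lia.
Qed.

Lemma term_bounded_dot_at n d f :
  bounded (d + n) f -> term_bounded n (dot_at d f).
Proof.
  revert d; induction f; intros d Hf; cbn [dot_at bounded] in *; unfold timp;
    try (destruct Hf); repeat apply term_bounded_tpair;
    auto using term_bounded_num, term_bounded_dot_term.
Qed.

Lemma term_bounded_dot n f : bounded n f -> term_bounded n (dot f).
Proof. apply (term_bounded_dot_at n 0). Qed.

(** The bound of a bounded quantifier is a shifted term, and [up s] maps shifted
    terms to shifted terms. *)
Lemma Delta0_subst s f : Delta0 f -> Delta0 (subst s f).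
Proof.
  intros Hf; revert s; induction Hf; intros s; cbn; try (constructor; auto; fail).
  - rewrite subst_term_up_shift; now constructor.
  - rewrite subst_term_up_shift; apply D0_BEx; auto.
Qed.

Lemma Sigma1_subst s f : Sigma1 f -> Sigma1 (subst s f).
Proof.
  intros Hf; revert s; induction Hf; intros s.
  - now apply S1_Delta0, Delta0_subst.
  - apply S1_Ex, IHHf.
Qed.

(** * Truth in the standard model *)

Lemma eval_ext_bounded n e e' t :
  term_bounded n t -> (forall i, i < n -> e i = e' i) -> eval e t = eval e' t.
Proof.
  intros Ht E; induction t; cbn in *; try tauto; try auto; f_equal; tauto.
Qed.

Lemma eval_subst e s t : eval e (subst_term s t) = eval (fun i => eval e (s i)) t.
Proof. induction t; cbn; congruence. Qed.

(** For the induction, the claim is generalized from [scons t Var] to a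
    substitution [s] of any number of variables. *)
Lemma sat_inst e f t :
  bounded 1 f -> sat e (inst f t) <-> sat (fun _ => eval e t) f.
Proof.
  enough (H : forall n f s e e', bounded n f ->
    (forall i, i < n -> eval e (s i) = e' i) -> sat e (subst s f) <-> sat e' f).
  { intros Hf; apply (H 1); [exact Hf|]; intros [|i] Hi; [reflexivity | lia]. }
  clear; intros n f; revert n.
  induction f as [|t u|t u|f1 IH1 f2 IH2|f IH]; intros n s e e' Hf E; cbn in *.
  - tauto.
  - destruct Hf as [Ht Hu]; rewrite !eval_subst.
    now rewrite (eval_ext_bounded n _ e' t), (eval_ext_bounded n _ e' u).
  - destruct Hf as [Ht Hu]; rewrite !eval_subst.
    now rewrite (eval_ext_bounded n _ e' t), (eval_ext_bounded n _ e' u).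
  - destruct Hf as [H1 H2]; rewrite (IH1 n s e e'), (IH2 n s e e'); tauto.
  - enough (H : forall m, sat (scons m e) (subst (up s) f) <-> sat (scons m e') f)
      by (split; intros Hs m; apply H, Hs).
    intros m; apply (IH (S n)); [exact Hf|].
    intros [|i] Hi; cbn; [reflexivity|].
    unfold shift_term; rewrite eval_subst; cbn; apply E; lia.
Qed.

(** * Natural deduction *)

Lemma weakening T G G' f : incl G G' -> derives T G f -> derives T G' f.
Proof.
  intros I D; revert G' I; induction D; intros G' I.
  - now apply Ax.
  - apply Hyp; auto.
  - apply ImpI, IHD; intros x [->|Hx]; [now left | right; auto].
  - eapply ImpE; eauto.
  - apply RAA, IHD; intros x [->|Hx]; [now left | right; auto].
  - apply AllI, IHD; now apply incl_map.
  - now apply AllE, IHD.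
  - apply EqI.
  - eapply EqE; eauto.
Qed.

Lemma derives_of_proves T G f : T |-- f -> derives T G f.
Proof. apply weakening; intros x []. Qed.

(** This is what lets open formulas, such as the axioms of arithmetic, the
    derivability conditions and the defining equivalences, be used at arbitrary
    terms.  The case [Ax] holds because substitution fixes sentences. *)
Lemma derives_subst T s G f :
  (forall f, T f -> sentence f) ->
  derives T G f -> derives T (map (subst s) G) (subst s f).
Proof.
  intros HT D; revert s; induction D; intros s; cbn in *.
  - rewrite subst_sentence; auto using Ax.
  - apply Hyp; now apply in_map.
  - apply ImpI, IHD.
  - eapply ImpE; [apply IHD1 | apply IHD2].
  - apply RAA, IHD.
  - apply AllI; specialize (IHD (up s)); rewrite map_map in *.
    erewrite map_ext; [exact IHD|]; intros g; symmetry; apply subst_shift.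
  - rewrite subst_inst; apply AllE, IHD.
  - apply EqI.
  - rewrite subst_inst; eapply EqE; [apply IHD1|].
    rewrite <- subst_inst; apply IHD2.
Qed.

Lemma proves_subst T s f :
  (forall f, T f -> sentence f) -> T |-- f -> T |-- subst s f.
Proof. intros HT D; exact (derives_subst T s [] f HT D). Qed.

Lemma proves_imp_trans T f g h :
  T |-- Imp f g -> T |-- Imp g h -> T |-- Imp f h.
Proof.
  intros D E; apply ImpI.
  eapply ImpE; [apply derives_of_proves, E|].
  eapply ImpE; [apply derives_of_proves, D | apply Hyp; now left].
Qed.

Lemma proves_imp_mp T f g h :
  T |-- Imp f (Imp g h) -> T |-- Imp f g -> T |-- Imp f h.
Proof.
  intros D E; apply ImpI.
  eapply ImpE; (eapply ImpE; [apply derives_of_proves | apply Hyp; now left]);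
    eassumption.
Qed.

Lemma proves_bot_imp T f : T |-- Imp Bot f.
Proof. apply ImpI, RAA, Hyp; right; now left. Qed.

Lemma proves_And T f g : T |-- And f g -> T |-- f /\ T |-- g.
Proof.
  intros D; split; apply RAA; (eapply ImpE; [apply derives_of_proves, D|]);
    apply ImpI.
  - apply RAA; eapply ImpE; [|apply Hyp; right; left; reflexivity].
    apply Hyp; right; right; now left.
  - apply Hyp; right; now left.
Qed.

Lemma proves_Iff T f g : T |-- Iff f g -> T |-- Imp f g /\ T |-- Imp g f.
Proof. apply proves_And. Qed.

Lemma derives_ExI T G f t : derives T G (inst f t) -> derives T G (Ex f).
Proof.
  intros D; apply ImpI; eapply ImpE.
  - apply (AllE T _ (Neg f) t), Hyp; now left.
  - eapply weakening; [|exact D]; intros x Hx; now right.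
Qed.

(** Leibniz's rule is applied to the formula [c(t) = c(x)]; shifting [c(t)]
    protects it from the substitution for x. *)
Lemma derives_eq_term T G c t u :
  derives T G (Eq t u) ->
  derives T G (Eq (subst_term (scons t Var) c) (subst_term (scons u Var) c)).
Proof.
  intros D.
  pose proof (EqE T G (Eq (shift_term (subst_term (scons t Var) c)) c) t u D) as H.
  cbn in H; rewrite !inst_shift_term in H; apply H, EqI.
Qed.

Lemma derives_eq_sym T G t u : derives T G (Eq t u) -> derives T G (Eq u t).
Proof.
  intros D; pose proof (EqE T G (Eq (Var 0) (shift_term t)) t u D) as H.
  cbn in H; rewrite !inst_shift_term in H; apply H, EqI.
Qed.

Lemma derives_eq_trans T G t u v :
  derives T G (Eq t u) -> derives T G (Eq u v) -> derives T G (Eq t v).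
Proof.
  intros D E; pose proof (EqE T G (Eq (shift_term t) (Var 0)) u v E) as H.
  cbn in H; rewrite !inst_shift_term in H; apply H, D.
Qed.

Lemma proves_imp_inst M c f t :
  arithmetical_theory M -> sentence c ->
  M |-- Imp c f -> M |-- Imp c (inst f t).
Proof.
  intros hM Hc D; apply (proves_subst _ (scons t Var)) in D; [|apply hM].
  cbn [subst] in D; now rewrite (subst_sentence _ c Hc) in D.
Qed.

Lemma proves_Iff_inst_mp M f g t :
  arithmetical_theory M -> M |-- Iff f g -> M |-- inst f t -> M |-- inst g t.
Proof.
  intros hM D E; apply proves_Iff in D as [D _].
  refine (ImpE _ _ _ _ _ E).
  exact (proves_subst _ (scons t Var) _ (axioms_closed _ hM) D).
Qed.

(** * Computation with closed terms *)

Lemma proves_EA M s f : arithmetical_theory M -> EA f -> M |-- subst s f.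
Proof.
  intros hM Hf; apply proves_subst; [apply hM | now apply hM].
Qed.

Lemma proves_plus_num M m n :
  arithmetical_theory M -> M |-- Eq (Plus (num m) (num n)) (num (m + n)).
Proof.
  intros hM; induction n as [|n IH].
  - rewrite Nat.add_0_r.
    exact (proves_EA M (scons (num m) Var) _ hM EA_plus_0).
  - rewrite Nat.add_succ_r; eapply derives_eq_trans.
    + exact (proves_EA M (scons (num m) (scons (num n) Var)) _ hM EA_plus_S).
    + exact (derives_eq_term M [] (Succ (Var 0)) _ _ IH).
Qed.

Lemma proves_mult_num M m n :
  arithmetical_theory M -> M |-- Eq (Mult (num m) (num n)) (num (m * n)).
Proof.
  intros hM; induction n as [|n IH].
  - rewrite Nat.mul_0_r.
    exact (proves_EA M (scons (num m) Var) _ hM EA_mult_0).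
  - rewrite Nat.mul_succ_r; eapply derives_eq_trans.
    { exact (proves_EA M (scons (num m) (scons (num n) Var)) _ hM EA_mult_S). }
    eapply derives_eq_trans; [|now apply proves_plus_num].
    pose proof (derives_eq_term M [] (Plus (Var 0) (num m)) _ _ IH) as H.
    cbn in H; now rewrite !subst_num in H.
Qed.

Lemma proves_eval M e t :
  arithmetical_theory M -> term_bounded 0 t -> M |-- Eq t (num (eval e t)).
Proof.
  intros hM; induction t as [i| |t IH|t IHt u IHu|t IHt u IHu]; cbn; intros Ht.
  - lia.
  - apply EqI.
  - exact (derives_eq_term M [] (Succ (Var 0)) _ _ (IH Ht)).
  - destruct Ht as [Ht Hu].
    eapply derives_eq_trans; [|now apply proves_plus_num].
    pose proof (derives_eq_term M [] (Plus (Var 0) (shift_term u)) _ _ (IHt Ht)) as E1.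
    pose proof (derives_eq_term M [] (Plus (num (eval e t)) (Var 0)) _ _ (IHu Hu)) as E2.
    cbn in E1, E2; rewrite !inst_shift_term in E1; rewrite !subst_num in E2.
    exact (derives_eq_trans _ _ _ _ _ E1 E2).
  - destruct Ht as [Ht Hu].
    eapply derives_eq_trans; [|now apply proves_mult_num].
    pose proof (derives_eq_term M [] (Mult (Var 0) (shift_term u)) _ _ (IHt Ht)) as E1.
    pose proof (derives_eq_term M [] (Mult (num (eval e t)) (Var 0)) _ _ (IHu Hu)) as E2.
    cbn in E1, E2; rewrite !inst_shift_term in E1; rewrite !subst_num in E2.
    exact (derives_eq_trans _ _ _ _ _ E1 E2).
Qed.

Lemma proves_eq_of_eval M e t u :
  arithmetical_theory M -> term_bounded 0 t -> term_bounded 0 u ->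
  eval e t = eval e u -> M |-- Eq t u.
Proof.
  intros hM Ht Hu E; eapply derives_eq_trans; [now apply (proves_eval M e)|].
  rewrite E; now apply derives_eq_sym, proves_eval.
Qed.

Lemma proves_lt_succ_num M k :
  arithmetical_theory M -> M |-- Lt (num k) (num (S k)).
Proof.
  intros hM.
  pose proof (proves_EA M (scons (num k) (scons (num (S k)) Var)) _ hM EA_lt) as H.
  apply proves_Iff in H as [_ H]; eapply ImpE; [exact H|].
  (* The order axiom asks for z with k + S z = S k. *)
  apply (derives_ExI M [] _ Zero); cbn.
  unfold shift_term; rewrite ?subst_num.
  apply (proves_eq_of_eval M (fun _ => 0)); cbn; auto using term_bounded_num.
  rewrite eval_num; lia.
Qed.

(** * The diagonal lemma and Loeb's theorem *)

(** For [x] the Goedel number of [g], this term mirrors the clauses of [gn] on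
    [All (Imp (Eq (Var 0) (num x)) g)], the second [tpair] being the code of
    [Eq (Var 0) (num x)].  A numeral has a code polynomial in its value, so no
    recursion on [x] is required. *)
Definition tdiag (x : term) : term :=
  tpair (num 4)
    (timp (tpair (num 1) (tpair (tpair (num 0) (tpair (num 0) (num 0)))
                                (tpair x (tpair (num 1) (num 0))))) x).

Lemma tdiag_spec e g :
  eval e (tdiag (num (gn g))) = gn (All (Imp (Eq (Var 0) (num (gn g))) g)).
Proof.
  unfold tdiag, timp; rewrite !eval_tpair, !eval_num; cbn [gn].
  now rewrite gn_num.
Qed.

Lemma diagonal M f :
  arithmetical_theory M -> bounded 1 f ->
  exists L, sentence L /\
    M |-- Imp L (inst f (dot L)) /\ M |-- Imp (inst f (dot L)) L.
Proof.
  intros hM Hf.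
  pose (g := inst f (tdiag (Var 0))).
  pose (L := All (Imp (Eq (Var 0) (num (gn g))) g)).
  assert (Hg : bounded 1 g).
  { apply bounded_inst; [exact Hf|]; cbn; lia. }
  assert (HL : sentence L).
  { cbn; repeat split; auto using term_bounded_num. }
  assert (Hgn : inst g (num (gn g)) = inst f (tdiag (num (gn g)))).
  { exact (subst_inst_bounded (scons (num (gn g)) Var) f (tdiag (Var 0)) Hf). }
  assert (E : M |-- Eq (tdiag (num (gn g))) (dot L)).
  { apply (proves_eq_of_eval M (fun _ => 0) _ _ hM).
    - cbn; repeat split; auto using term_bounded_num.
    - now apply term_bounded_dot.
    - rewrite tdiag_spec, dot_spec, (subst_sentence _ L HL); reflexivity. }
  exists L; split; [exact HL|]; split.
  - apply ImpI; apply (EqE _ _ f _ _ (derives_of_proves _ _ _ E)).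
    rewrite <- Hgn.
    eapply ImpE; [|apply (EqI _ _ (num (gn g)))].
    assert (D : derives M [L] L) by (apply Hyp; now left).
    apply (AllE _ _ _ (num (gn g))) in D; cbn in D.
    rewrite subst_num in D; exact D.
  - apply ImpI, AllI, ImpI; cbn [map].
    refine (eq_ind (inst g (Var 0)) (derives M _) _ _ (inst_Var0 g Hg)).
    apply (EqE _ _ g (num (gn g))).
    + apply derives_eq_sym, Hyp; now left.
    + rewrite Hgn; apply (EqE _ _ f (dot L)).
      * now apply derives_of_proves, derives_eq_sym.
      * apply Hyp; right; left; apply subst_sentence.
        apply bounded_inst; [exact Hf | now apply term_bounded_dot].
Qed.

(** The term [timp (dot f) (dot g)] is [dot (Imp f g)] by definition, so this is
    an instance of [GD2] even when [f] and [g] have free variables. *)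
Lemma proves_box_imp M Box f g :
  arithmetical_theory M -> provability_predicate M Box ->
  M |-- Imp (inst Box (dot (Imp f g)))
            (Imp (inst Box (dot f)) (inst Box (dot g))).
Proof.
  intros hM hB.
  pose proof (proves_subst M (scons (dot f) (scons (dot g) Var)) _
                (axioms_closed _ hM) (GD2 _ _ hB)) as H.
  cbn [subst] in H.
  rewrite !(subst_inst_bounded _ Box _ (box_one_free _ _ hB)) in H.
  exact H.
Qed.

Lemma proves_box_mono M Box f g :
  arithmetical_theory M -> provability_predicate M Box ->
  bounded 1 f -> bounded 1 g -> M |-- Imp f g ->
  M |-- Imp (inst Box (dot f)) (inst Box (dot g)).
Proof.
  intros hM hB Hf Hg D; eapply ImpE; [now apply proves_box_imp|].
  apply (GD1 _ _ hB); [now split | exact D].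
Qed.

Lemma bounded_box M Box n f :
  provability_predicate M Box -> bounded n f -> bounded n (inst Box (dot f)).
Proof.
  intros hB Hf; apply bounded_inst; [apply hB | now apply term_bounded_dot].
Qed.

(** The usual argument: with [L] equivalent to [B L -> p], provability of
    [L -> (B L -> p)] gives [B L -> B (B L) -> B p], and [B L -> B (B L)] holds
    as [B L] is Sigma_1; so [B L -> p], which is [L], hence [B L], hence [p]. *)
Lemma Loeb M Box p :
  arithmetical_theory M -> provability_predicate M Box -> sentence p ->
  M |-- Imp (inst Box (dot p)) p -> M |-- p.
Proof.
  intros hM hB Hp D.
  destruct (diagonal M (Imp Box p) hM) as (L & HL & D1 & D2).
  { split; [apply hB | now apply sentence_bounded]. }
  change (inst (Imp Box p) (dot L))
    with (Imp (inst Box (dot L)) (inst p (dot L))) in D1, D2.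
  unfold inst at 2 in D1; unfold inst at 2 in D2.
  rewrite (subst_sentence _ p Hp) in D1, D2.
  assert (HBL : sentence (inst Box (dot L))) by now apply (bounded_box M).
  assert (E : M |-- Imp (inst Box (dot L)) p).
  { eapply proves_imp_trans; [|exact D].
    apply (proves_imp_mp _ _ (inst Box (dot (inst Box (dot L))))).
    - eapply proves_imp_trans; [|now apply proves_box_imp].
      apply proves_box_mono; auto using sentence_bounded.
      split; now apply sentence_bounded.
    - apply (GD3 _ _ hB), Sigma1_subst, hB. }
  eapply ImpE; [exact E|].
  apply (GD1 _ _ hB); [now apply sentence_bounded|].
  eapply ImpE; [exact D2 | exact E].
Qed.

(** A consistent theory asserts the unprovability of nothing: the refuted
    instance follows from [B Bot], so this is Loeb's theorem for [Bot]. *)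
Lemma inconsistent_of_refuted_box M Box f k :
  arithmetical_theory M -> provability_predicate M Box -> bounded 1 f ->
  M |-- Neg (inst (inst Box (dot f)) (num k)) -> M |-- Bot.
Proof.
  intros hM hB Hf D; apply (Loeb M Box); auto; [exact I|].
  refine (proves_imp_trans _ _ _ _ _ D).
  assert (E : M |-- Imp (inst Box (dot Bot)) (inst Box (dot f))).
  { apply proves_box_mono; auto; [exact I | apply proves_bot_imp]. }
  apply proves_imp_inst; [exact hM | now apply (bounded_box M) | exact E].
Qed.

(** The variable of [dot f] makes the truth of [B f] at [e] mean provability of
    the instance of [f] at the value of that variable. *)
Lemma proves_of_box_true M Box f e :
  provability_predicate M Box -> bounded 1 f ->
  sat e (inst Box (dot f)) -> M |-- inst f (num (e 0)).
Proof.
  intros hB Hf Hs; apply sat_inst in Hs; [|apply hB].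
  rewrite dot_spec in Hs; apply (box_true _ _ hB) in Hs as (g & E & D).
  apply gn_inj in E; subst g.
  rewrite (subst_ext_bounded 1 _ (scons (num (e 0)) Var)) in D; [exact D | exact Hf |].
  intros [|i] Hi; [reflexivity | lia].
Qed.

Lemma one_consistent_consistent M : one_consistent M -> consistent M.
Proof.
  intros H D; exact (H Bot (S1_Delta0 _ D0_Bot) I D (fun _ => 0)).
Qed.

(** * The three fixed points *)

Lemma proves_all_above M c f :
  sentence c -> M |-- Imp c f -> M |-- Imp c (all_above f).
Proof.
  intros Hc D; apply ImpI, AllI, ImpI; cbn.
  unfold shift; rewrite (subst_sentence _ c Hc).
  eapply ImpE; [apply derives_of_proves, D|]; apply Hyp; right; now left.
Qed.

Lemma proves_all_above_instance M f k :
  arithmetical_theory M -> bounded 1 f ->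
  M |-- inst (all_above f) (num k) -> M |-- inst f (num (S k)).
Proof.
  intros hM Hf D; unfold all_above, inst in D; cbn [subst] in D.
  rewrite (subst_bounded_id 1 _ f Hf) in D.
  2: { intros [|i] Hi; [reflexivity | lia]. }
  apply (AllE _ _ _ (num (S k))) in D.
  cbn in D; unfold shift_term in D; rewrite !subst_num in D.
  eapply ImpE; [exact D | now apply proves_lt_succ_num].
Qed.

Theorem theorem5 (M : form -> Prop) (Box YJ YG YH : form)
  (hM : arithmetical_theory M)
  (hBox : provability_predicate M Box)
  (hJ1 : bounded 1 YJ) (hG1 : bounded 1 YG) (hH1 : bounded 1 YH)
  (hJ : M |-- Iff YJ (all_above (inst Box (dot (Neg YJ)))))
  (hG : M |-- Iff YG (all_above (Neg (inst Box (dot YG)))))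
  (hH : M |-- Iff YH (all_above (inst Box (dot YH)))) :
  (forall k : nat,
     (one_consistent M -> ~ (M |-- inst YJ (num k))) /\
     (consistent M -> ~ (M |-- Neg (inst YJ (num k))))) /\
  (forall k : nat,
     (consistent M -> ~ (M |-- inst YG (num k))) /\
     (one_consistent M -> ~ (M |-- Neg (inst YG (num k))))) /\
  (M |-- YH).
Proof.
  assert (refuteJ : forall k, consistent M -> ~ (M |-- Neg (inst YJ (num k)))).
  { intros k C D; apply C, (Loeb M Box); auto; [exact I|].
    apply (proves_imp_trans _ _ (inst YJ (num k))); [|exact D].
    assert (E : M |-- Imp (inst Box (dot Bot)) YJ).
    { eapply proves_imp_trans; [|exact (proj2 (proves_Iff _ _ _ hJ))].
      apply proves_all_above; [now apply (bounded_box M)|].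
      apply proves_box_mono; auto; [exact I | now split | apply proves_bot_imp]. }
    apply proves_imp_inst; [exact hM | now apply (bounded_box M) | exact E]. }
  assert (proveG : forall k, consistent M -> ~ (M |-- inst YG (num k))).
  { intros k C D; apply C.
    apply (inconsistent_of_refuted_box M Box YG (S k)); auto.
    apply (proves_all_above_instance M (Neg (inst Box (dot YG)))); auto.
    { split; [now apply (bounded_box M) | exact I]. }
    exact (proves_Iff_inst_mp _ _ _ _ hM hG D). }
  split; [|split].
  - intros k; split; [|apply refuteJ].
    (* The instance at k + 1 asserts, hence truly, that Neg YJ(k+1) is provable. *)
    intros C D; apply (refuteJ (S k)); [now apply one_consistent_consistent|].
    assert (HB : bounded 1 (inst Box (dot (Neg YJ)))).
    { apply (bounded_box M); [exact hBox | now split]. }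
    assert (E : M |-- inst (inst Box (dot (Neg YJ))) (num (S k))).
    { apply proves_all_above_instance; auto.
      exact (proves_Iff_inst_mp _ _ _ _ hM hJ D). }
    apply C in E.
    + specialize (E (fun _ => 0)); apply sat_inst in E; [|exact HB].
      apply (proves_of_box_true M) in E; [|exact hBox | now split].
      rewrite eval_num in E; exact E.
    + apply Sigma1_subst, Sigma1_subst, hBox.
    + apply bounded_inst; [exact HB | apply term_bounded_num].
  - intros k; split; [apply proveG|]; intros C D.
    assert (HB : bounded 1 (inst Box (dot YG))) by now apply (bounded_box M).
    (* The refutation of YG(k) gives a witness above k of B YG; forgetting that
       bound leaves a formula that is literally Sigma_1. *)
    pose (a := All (Neg (inst Box (dot YG)))).
    assert (Ha : sentence a) by (split; [exact HB | exact I]).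
    assert (E : M |-- Ex (inst Box (dot YG))).
    { apply (proves_imp_trans _ _ (inst YG (num k))); [|exact D].
      assert (E : M |-- Imp a YG).
      { eapply proves_imp_trans; [|exact (proj2 (proves_Iff _ _ _ hG))].
        apply proves_all_above; [exact Ha|].
        apply ImpI; rewrite <- (inst_Var0 (Neg _)) by (split; [exact HB | exact I]).
        apply AllE, Hyp; now left. }
      now apply proves_imp_inst. }
    apply C in E.
    + specialize (E (fun _ => 0)); cbn in E; apply E; intros n Hn.
      apply (proveG n); [now apply one_consistent_consistent|].
      exact (proves_of_box_true M Box YG _ hBox hG1 Hn).
    + apply S1_Ex, Sigma1_subst, hBox.
    + repeat split; exact HB.
  - assert (Ha : sentence (All YH)) by exact hH1.
    assert (E : M |-- Imp (All YH) YH).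
    { apply ImpI; rewrite <- (inst_Var0 YH hH1) at 2; apply AllE, Hyp; now left. }
    refine (ImpE _ _ _ _ E _); apply (Loeb M Box); auto.
    assert (HBa : sentence (inst Box (dot (All YH)))) by now apply (bounded_box M).
    apply ImpI, AllI; cbn.
    unfold shift; rewrite (subst_sentence _ _ HBa).
    eapply ImpE; [|apply Hyp; now left]; apply derives_of_proves.
    eapply proves_imp_trans; [|exact (proj2 (proves_Iff _ _ _ hH))].
    apply proves_all_above; [exact HBa|].
    apply proves_box_mono; auto using sentence_bounded.
Qed.
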